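(* Let $N$ be a positive integer, $E_1,E_2\subseteq\mathbb{Z}_N$ with $|E_1|=\beta_1N$, $|E_2|=\beta_2N$, and let $A\subseteq E_1\times E_2$ with $|A|=\delta|E_1||E_2|$, $\delta>0$. Suppose: $E_1$ and $E_2$ are $10^{-330}\beta_1^{24}\beta_2^{24}\delta^{132}$-uniform; $A$ is $\alpha$-uniform with respect to the basis $(\vec e_1,\vec e_2)$, where $\alpha=10^{-108}\delta^{44}$; $N\ge10^{10}(\delta^4\beta_1\beta_2)^{-1}$; and $\sum_{y\in E_2}|\delta_y-\delta|^2\le\alpha\beta_2N$. Then $A$ contains a corner, i.e. there are $(a,b)\in\mathbb{Z}_N^2$ and $d\in\mathbb{Z}_N\setminus\{0\}$ with $(a,b),(a+d,b),(a,b+d)\in A$.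
   Context: A set $E\subseteq\mathbb{Z}_N$ with $|E|=\beta N$ is $\gamma$-uniform if $\phi=\chi_E-\beta$ satisfies $\sum_{k\in\mathbb{Z}_N}\big|\sum_{s}\phi(s)\overline{\phi(s-k)}\big|^2\le\gamma N^3$. For $A\subseteq E_1\times E_2$ and $y\in\mathbb{Z}_N$ let $\delta_y=\frac{1}{|E_1|}|\{x\in E_1:(x,y)\in A\}|$, and let the balanced function of $A$ be $f(x,y)=(\chi_A(x,y)-\delta_y)\chi_{E_1\times E_2}(x,y)$. $A$ is $\alpha$-uniform with respect to the basis $(\vec e_1,\vec e_2)$ (where $\vec e_1=(1,0)$, $\vec e_2=(0,-1)$) if $\sum_{y,y'\in\mathbb{Z}_N}\big|\sum_{x\in\mathbb{Z}_N}f(x,y)\overline{f(x,y')}\big|^2\le\alpha|E_1|^2|E_2|^2$. *)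

(* Defs.v *)
From mathcomp Require Import all_boot all_order all_algebra.

Set Implicit Arguments.
Unset Strict Implicit.
Unset Printing Implicit Defensive.

Import Order.TTheory GRing.Theory Num.Theory.

Local Open Scope ring_scope.

(* Z_N for N = n.+1 is the additive group 'I_n.+1, which is Z/NZ for every
   N >= 1 ('Z_N would be Z/2Z at N = 1).  Only its additive structure occurs.
   All functions below are real-valued, so complex conjugation is omitted. *)

Definition indicator (R : rcfType) (T : finType) (S : {set T}) (x : T) : R :=
  (x \in S)%:R.

Definition set_density (R : rcfType) (n : nat) (E : {set 'I_n.+1}) : R :=
  #|E|%:R / n.+1%:R.

Definition balanced_set (R : rcfType) (n : nat) (E : {set 'I_n.+1})
    (s : 'I_n.+1) : R :=
  indicator R E s - set_density R E.

Definition set_uniform (R : rcfType) (n : nat) (gamma : R)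
    (E : {set 'I_n.+1}) : Prop :=
  \sum_(k : 'I_n.+1)
     `| \sum_(s : 'I_n.+1) balanced_set R E s * balanced_set R E (s - k) | ^+ 2
  <= gamma * n.+1%:R ^+ 3.

Definition fiber_density (R : rcfType) (n : nat) (E1 : {set 'I_n.+1})
    (A : {set 'I_n.+1 * 'I_n.+1}) (y : 'I_n.+1) : R :=
  #|[set x in E1 | (x, y) \in A]|%:R / #|E1|%:R.

Definition balanced_rel (R : rcfType) (n : nat) (E1 E2 : {set 'I_n.+1})
    (A : {set 'I_n.+1 * 'I_n.+1}) (x y : 'I_n.+1) : R :=
  (indicator R A (x, y) - fiber_density R E1 A y)
  * indicator R (setX E1 E2) (x, y).

(* Uniformity with respect to the basis ((1,0), (0,-1)). *)
Definition basis_uniform (R : rcfType) (n : nat) (alpha : R)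
    (E1 E2 : {set 'I_n.+1}) (A : {set 'I_n.+1 * 'I_n.+1}) : Prop :=
  \sum_(y : 'I_n.+1) \sum_(y' : 'I_n.+1)
     `| \sum_(x : 'I_n.+1)
          balanced_rel R E1 E2 A x y * balanced_rel R E1 E2 A x y' | ^+ 2
  <= alpha * #|E1|%:R ^+ 2 * #|E2|%:R ^+ 2.

Definition has_corner (n : nat) (A : {set 'I_n.+1 * 'I_n.+1}) : Prop :=
  exists a b d : 'I_n.+1,
    [/\ d != 0, (a, b) \in A, (a + d, b) \in A & (a, b + d) \in A].

(* Main.v *)
Require Import Defs.
From mathcomp Require Import all_boot all_order all_algebra.
From mathcomp Require Import ring lra.

Set Implicit Arguments.
Unset Strict Implicit.
Unset Printing Implicit Defensive.

Import Order.TTheory GRing.Theory Num.Theory.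

Local Open Scope ring_scope.

(* With 1_A(x,y) = a(x,y), the corners, degenerate ones included, are counted by
     T(a,a,a) = sum_{x,y,z} a(x,y) a(z-y,y) a(x,z-x).
   Write a = delta 1_{E1 x E2} + g in the first slot.  The factor 1_{E1}(x) 1_{E2}(y)
   is implied by the two others, so the main term is delta sum_z r(z)^2, with
   r(z) the number of points of A on the antidiagonal z; it is at least
   delta |A|^2 / N.  Two weighted Cauchy-Schwarz steps bound T(g,a,a)^4 by
   (|E1||E2|)^2 times the number of quadruples e1 + e2 = e1' + e2', times
   sum g(x,y) g(x,y') g(x',y) g(x',y') W, where
   W = sum_z E1(z-y) E1(z-y') E2(z-x) E2(z-x').  Uniformity of E1 and E2 makes W
   concentrate around beta1^2 beta2^2 N in L^2, and the remaining box norm of g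
   is O(alpha) by uniformity of A together with the bound on the variance of the
   fibre densities.  Hence T(a,a,a) exceeds the number |A| of degenerate corners. *)

(** * Weighted Cauchy-Schwarz inequalities *)

Lemma weighted_cauchy_schwarz (R : realFieldType) (I : finType) (a F : I -> R) :
  (forall i, 0 <= a i) ->
  (\sum_i a i * F i) ^+ 2 <= (\sum_i a i) * \sum_i a i * F i ^+ 2.
Proof.
move=> a_ge0.
(* Lagrange's identity: this nonnegative double sum is twice the gap between the two sides. *)
have : 0 <= \sum_i \sum_j a i * a j * (F i - F j) ^+ 2.
  by apply: sumr_ge0 => i _; apply: sumr_ge0 => j _;
    rewrite mulr_ge0 ?sqr_ge0 ?mulr_ge0.
suff -> : \sum_i \sum_j a i * a j * (F i - F j) ^+ 2 =
  2 * ((\sum_i a i) * (\sum_i a i * F i ^+ 2) - (\sum_i a i * F i) ^+ 2).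
  by rewrite pmulr_rge0 // subr_ge0.
transitivity (\sum_i (a i * F i ^+ 2 * (\sum_j a j)
    + a i * (\sum_j a j * F j ^+ 2) - 2 * (a i * F i) * (\sum_j a j * F j))).
  apply: eq_bigr => i _; rewrite !mulr_sumr -big_split -sumrB /=.
  by apply: eq_bigr => j _; ring.
by rewrite sumrB big_split /= -!mulr_suml -mulr_sumr; ring.
Qed.

(** Used with [a] built from the indicator of A and [w] from those of E1 and E2, so that a factor of
    A is traded for a weight whose sums can be computed. *)
Lemma dominated_cauchy_schwarz (R : realFieldType) (I : finType)
    (a w F : I -> R) :
  (forall i, 0 <= a i <= w i) ->
  (\sum_i a i * F i) ^+ 2 <= (\sum_i w i) * \sum_i w i * F i ^+ 2.
Proof.
move=> aw; apply: (le_trans (weighted_cauchy_schwarz _ _)) => [i|].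
  by case/andP: (aw i).
apply: ler_pM; do ?[apply: sumr_ge0 | apply: ler_sum] => i _;
  case/andP: (aw i) => // a_ge0 a_le.
- by rewrite mulr_ge0 ?sqr_ge0.
- by rewrite ler_wpM2r ?sqr_ge0.
Qed.

Lemma sqr_sum_le (R : realFieldType) (I : finType) (F : I -> R) :
  (\sum_i F i) ^+ 2 <= #|I|%:R * \sum_i F i ^+ 2.
Proof.
have := @weighted_cauchy_schwarz R I (fun=> 1) F (fun=> ler01).
rewrite sumr_const; under eq_bigr do rewrite mul1r.
by under [X in _ <= _ * X -> _]eq_bigr do rewrite mul1r.
Qed.

(** * Autocorrelations on a finite abelian group *)

Section Group.
Variables (R : realFieldType) (G : finZmodType).
Implicit Types (e : G -> R) (f g h : G -> G -> R).

Lemma sum_translate (F : G -> R) (c : G) : \sum_x F (x - c) = \sum_x F x.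
Proof. by rewrite [RHS](reindex_inj (addIr (- c))). Qed.

Lemma sum_reflect (F : G -> R) (c : G) : \sum_x F (c - x) = \sum_x F x.
Proof. by rewrite [RHS](reindex_inj (@subrI G c)). Qed.

Lemma sqr_sum_pair (I : finType) (F : I -> R) :
  (\sum_i F i) ^+ 2 = \sum_(v : I * I) F v.1 * F v.2.
Proof.
rewrite -(pair_bigA _ (fun i j => F i * F j)) /= expr2 mulr_suml.
by apply: eq_bigr => i _; rewrite mulr_sumr.
Qed.

Definition autocorr e (k : G) : R := \sum_s e s * e (s - k).

Lemma autocorr_shift e (z w : G) :
  \sum_y e (z - y) * e (w - y) = autocorr e (z - w).
Proof.
rewrite /autocorr -[RHS](sum_reflect _ z); apply: eq_bigr => y _.
by congr (_ * e _); rewrite opprB [RHS]addrC addrA subrK.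
Qed.

Lemma autocorr_shift2 e (y y' : G) :
  \sum_z e (z - y) * e (z - y') = autocorr e (y' - y).
Proof.
rewrite /autocorr -[RHS](sum_translate _ y); apply: eq_bigr => z _.
by congr (_ * e _); rewrite opprB addrA subrK.
Qed.

Lemma autocorr_bounds e k : (forall x, 0 <= e x <= 1) ->
  0 <= autocorr e k <= #|G|%:R.
Proof.
move=> e01; rewrite /autocorr; apply/andP; split.
  by apply: sumr_ge0 => s _; case/andP: (e01 s) (e01 (s - k)) => ? _ /andP[? _];
     rewrite mulr_ge0.
rewrite -sumr_const; apply: ler_sum => s _.
by case/andP: (e01 s) (e01 (s - k)) => ? ? /andP[? ?]; rewrite mulr_ile1.
Qed.

(** On expanding the balanced product, each of the two cross terms sums to [- b ^+ 2 * #|G|%:R] and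
    the constant term restores one of them. *)
Lemma autocorr_balanced e (b : R) k : \sum_s e s = b * #|G|%:R ->
  autocorr e k = b ^+ 2 * #|G|%:R + autocorr (fun s => e s - b) k.
Proof.
move=> sum_e; rewrite /autocorr.
have -> : \sum_s (e s - b) * (e (s - k) - b) =
  \sum_s (e s * e (s - k) + (- b * e s - b * e (s - k) + b ^+ 2)).
  by apply: eq_bigr => s _; ring.
rewrite big_split /= !big_split /= sumrN -!mulr_sumr (sum_translate e) sum_e.
by rewrite sumr_const -[_ *+ #|_|]mulr_natr; ring.
Qed.

Lemma sum_sub (F : G -> R) : \sum_z \sum_w F (z - w) = #|G|%:R * \sum_k F k.
Proof.
under eq_bigr do rewrite sum_reflect.
by rewrite sumr_const -[LHS]mulr_natl.
Qed.

(** Both sides weigh the solutions of x + y = x' + y', grouped on the left by the common sum and on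
    the right by the common difference x - x' = y' - y. *)
Lemma convolution_energy (e1 e2 : G -> R) :
  \sum_z (\sum_y e1 (z - y) * e2 y) ^+ 2 =
  \sum_k autocorr e1 k * autocorr e2 k.
Proof.
transitivity (\sum_y' \sum_y e2 y' * e2 y * autocorr e1 (y' - y)).
  under eq_bigr do rewrite expr2 mulr_suml.
  under eq_bigr do under eq_bigr do rewrite mulr_sumr.
  rewrite exchange_big /=; under eq_bigr do rewrite exchange_big /=.
  rewrite exchange_big /=; apply: eq_bigr => y' _; apply: eq_bigr => y _.
  rewrite -autocorr_shift2 mulr_sumr; apply: eq_bigr => z _; ring.
transitivity (\sum_s \sum_k autocorr e1 k * (e2 s * e2 (s - k))).
  apply: eq_bigr => s _; rewrite -[LHS](sum_reflect _ s).
  by apply: eq_bigr => k _; rewrite subKr; ring.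
by rewrite exchange_big /=; apply: eq_bigr => k _; rewrite mulr_sumr.
Qed.

(** * Moments of the weight W, and the box norm *)

Definition pair_weight e (z : G) (u : G * G) : R := e (z - u.1) * e (z - u.2).

(** This is W for [u] = (x, x') and [v] = (y, y'): [e2] is evaluated at z - x and [e1] at z - y,
    hence the crossing of indices. *)
Definition cube_weight (e1 e2 : G -> R) (u v : G * G) : R :=
  \sum_z pair_weight e2 z u * pair_weight e1 z v.

(** The product of [g] over the four vertices of a rectangle; summed over all [u] and [v] it gives
    the fourth power of the box norm. *)
Definition box g (u v : G * G) : R :=
  (g u.1 v.1 * g u.1 v.2) * (g u.2 v.1 * g u.2 v.2).

Lemma sum_pair_weight e z : \sum_u pair_weight e z u = (\sum_x e x) ^+ 2.
Proof. by rewrite -(sum_reflect e z) sqr_sum_pair. Qed.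

Lemma sum_pair_weight2 e z w :
  \sum_u pair_weight e z u * pair_weight e w u = autocorr e (z - w) ^+ 2.
Proof.
rewrite -autocorr_shift sqr_sum_pair; apply: eq_bigr => u _.
by rewrite /pair_weight mulrACA.
Qed.

Lemma sum_cube_weight (e1 e2 : G -> R) :
  \sum_u \sum_v cube_weight e1 e2 u v =
  #|G|%:R * (\sum_x e1 x) ^+ 2 * (\sum_x e2 x) ^+ 2.
Proof.
rewrite /cube_weight.
under eq_bigr do rewrite exchange_big /=.
under eq_bigr do under eq_bigr do rewrite -mulr_sumr sum_pair_weight.
rewrite exchange_big /=.
under eq_bigr do rewrite -mulr_suml sum_pair_weight.
by rewrite sumr_const -[LHS]mulr_natl; ring.
Qed.

(** Squaring introduces a second variable w beside z. For fixed z and w the sums over [u] and [v]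
    separate, each being a squared autocorrelation at z - w. *)
Lemma sum_cube_weight_sqr (e1 e2 : G -> R) :
  \sum_u \sum_v cube_weight e1 e2 u v ^+ 2 =
  #|G|%:R * \sum_k autocorr e1 k ^+ 2 * autocorr e2 k ^+ 2.
Proof.
rewrite -(sum_sub (fun k => autocorr e1 k ^+ 2 * autocorr e2 k ^+ 2)).
transitivity (\sum_u \sum_v \sum_z \sum_w
   (pair_weight e2 z u * pair_weight e2 w u)
   * (pair_weight e1 z v * pair_weight e1 w v)).
  apply: eq_bigr => u _; apply: eq_bigr => v _.
  rewrite /cube_weight expr2 mulr_suml; apply: eq_bigr => z _.
  by rewrite mulr_sumr; apply: eq_bigr => w _; rewrite mulrACA.
under eq_bigr do rewrite exchange_big /=.
rewrite exchange_big /=; apply: eq_bigr => z _.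
under eq_bigr do rewrite exchange_big /=.
rewrite exchange_big /=; apply: eq_bigr => w _.
under eq_bigr do rewrite -mulr_sumr sum_pair_weight2.
by rewrite -mulr_suml sum_pair_weight2 mulrC.
Qed.

Lemma sum_box g :
  \sum_u \sum_v box g u v = \sum_y \sum_y' (\sum_x g x y * g x y') ^+ 2.
Proof.
rewrite exchange_big /= (pair_bigA _ (fun y y' => (\sum_x g x y * g x y') ^+ 2)).
by apply: eq_bigr => v _; rewrite sqr_sum_pair.
Qed.

(** * Control of corner sums by a weighted box norm *)

(* The variable [z] is [x + y + d] for the corner [(x, y), (x + d, y), (x, y + d)]. *)
Definition corner_sum f g h : R :=
  \sum_x \sum_y \sum_z f x y * g (z - y) y * h x (z - x).

(** Cauchy-Schwarz over (x, z) removes the factor [a x (z - x)] and doubles y into (y, y'); a second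
    one over (y, y', z) removes the other two factors [a] and doubles x. What remains is [g] at the
    vertices of a rectangle, weighted by W. *)
Lemma corner_sum_cauchy_schwarz (e1 e2 : G -> R) (a g : G -> G -> R) :
  (forall x, 0 <= e1 x <= 1) -> (forall x, 0 <= e2 x <= 1) ->
  (forall x y, 0 <= a x y <= e1 x * e2 y) ->
  corner_sum g a a ^+ 4 <=
    ((\sum_x e1 x) * \sum_x e2 x) ^+ 2
    * (\sum_k autocorr e1 k * autocorr e2 k)
    * \sum_u \sum_v box g u v * cube_weight e1 e2 u v.
Proof.
move=> e1_01 e2_01 a_le.
have e1_ge0 x : 0 <= e1 x by case/andP: (e1_01 x).
have e1_le1 x : e1 x <= 1 by case/andP: (e1_01 x).
have e2_ge0 x : 0 <= e2 x by case/andP: (e2_01 x).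
have e2_le1 x : e2 x <= 1 by case/andP: (e2_01 x).
have a_ge0 x y : 0 <= a x y by case/andP: (a_le x y).
(* Here [p] is (x, z). Of the majorant [e1 x * e2 (z - x)] only the factor [e2] is kept; once x is
   doubled it supplies the [e2] half of W. *)
pose Q := \sum_(p : G * G) e2 (p.2 - p.1)
            * (\sum_y g p.1 y * a (p.2 - y) y) ^+ 2.
pose V := \sum_u \sum_v box g u v * cube_weight e1 e2 u v.
have le1 : corner_sum g a a ^+ 2 <= ((\sum_x e1 x) * \sum_x e2 x) * Q.
  have -> : corner_sum g a a = \sum_(p : G * G) a p.1 (p.2 - p.1)
      * \sum_y g p.1 y * a (p.2 - y) y.
    rewrite -(pair_bigA _ (fun x z => a x (z - x) * \sum_y g x y * a (z - y) y)).
    apply: eq_bigr => x _ /=; rewrite exchange_big /=; apply: eq_bigr => z _.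
    by rewrite mulr_sumr; apply: eq_bigr => y _; rewrite mulrC.
  have -> : (\sum_x e1 x) * (\sum_x e2 x)
      = \sum_(p : G * G) e1 p.1 * e2 (p.2 - p.1).
    rewrite -(pair_bigA _ (fun x z => e1 x * e2 (z - x))) mulr_suml /=.
    by apply: eq_bigr => x _; rewrite -mulr_sumr sum_translate.
  apply: (le_trans (dominated_cauchy_schwarz _ _)) => [p|]; first exact: a_le.
  rewrite ler_wpM2l //; first by apply: sumr_ge0 => p _; rewrite mulr_ge0.
  apply: ler_sum => p _; rewrite ler_wpM2r ?sqr_ge0 //.
  by rewrite ler_piMl.
have le2 : Q ^+ 2 <= (\sum_k autocorr e1 k * autocorr e2 k) * V.
  pose H (q : (G * G) * G) :=
    \sum_x e2 (q.2 - x) * (g x q.1.1 * g x q.1.2).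
  have -> : Q = \sum_(q : (G * G) * G)
      a (q.2 - q.1.1) q.1.1 * a (q.2 - q.1.2) q.1.2 * H q.
    rewrite -(pair_bigA _ (fun v z => a (z - v.1) v.1 * a (z - v.2) v.2 * H (v, z))).
    rewrite /Q -(pair_bigA _ (fun x z => e2 (z - x)
            * (\sum_y g x y * a (z - y) y) ^+ 2)) /=.
    rewrite exchange_big [RHS]exchange_big /=; apply: eq_bigr => z _.
    under eq_bigr do rewrite sqr_sum_pair mulr_sumr.
    rewrite exchange_big /=; apply: eq_bigr => v _.
    by rewrite /H mulr_sumr; apply: eq_bigr => x _ /=; ring.
  pose w (q : (G * G) * G) :=
    (e1 (q.2 - q.1.1) * e2 q.1.1) * (e1 (q.2 - q.1.2) * e2 q.1.2).
  (* The total mass of [w] weighs pairs of representations of z as a sum, so it is the energy. *)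
  have -> : \sum_k autocorr e1 k * autocorr e2 k = \sum_q w q.
    rewrite -convolution_energy -(pair_bigA _ (fun v z => w (v, z))) /=.
    by rewrite exchange_big; apply: eq_bigr => z _; rewrite sqr_sum_pair.
  have w_ge0 q : 0 <= w q by rewrite /w !mulr_ge0.
  apply: (le_trans (dominated_cauchy_schwarz (w := w) _ _)) => [q|].
    have /andP[? ?] := a_le (q.2 - q.1.1) q.1.1.
    have /andP[? ?] := a_le (q.2 - q.1.2) q.1.2.
    by rewrite mulr_ge0 //= ler_pM.
  rewrite ler_wpM2l ?sumr_ge0 //.
  have -> : V = \sum_q pair_weight e1 q.2 q.1 * H q ^+ 2.
    rewrite -(pair_bigA _ (fun v z => pair_weight e1 z v * H (v, z) ^+ 2)) /=.
    rewrite /V exchange_big; apply: eq_bigr => v _ /=.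
    transitivity (\sum_u \sum_z box g u v * (pair_weight e2 z u * pair_weight e1 z v)).
      by apply: eq_bigr => u _; rewrite mulr_sumr.
    rewrite exchange_big; apply: eq_bigr => z _ /=.
    rewrite sqr_sum_pair mulr_sumr; apply: eq_bigr => u _.
    by rewrite /box /pair_weight /=; ring.
  (* Bounding the two factors [e2] of [w] by 1 leaves the [e1] half of W. *)
  apply: ler_sum => q _; rewrite ler_wpM2r ?sqr_ge0 // /w /pair_weight.
  by rewrite ler_pM ?mulr_ge0 // ler_piMr.
have s_ge0 : 0 <= (\sum_x e1 x) * \sum_x e2 x by rewrite mulr_ge0 ?sumr_ge0.
rewrite -[4%N]/(2 * 2)%N exprM.
apply: (@le_trans _ _ ((((\sum_x e1 x) * \sum_x e2 x) * Q) ^+ 2)).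
  by rewrite lerXn2r ?nnegrE ?sqr_ge0 // (le_trans (sqr_ge0 _) le1).
by rewrite exprMn -mulrA ler_wpM2l ?sqr_ge0.
Qed.

(** * Consequences of the uniformity of the two sets *)

Lemma sum_norm_autocorr e (q : R) : 0 <= q ->
  \sum_k autocorr e k ^+ 2 <= q ^+ 2 * #|G|%:R ^+ 3 ->
  \sum_k `|autocorr e k| <= q * #|G|%:R ^+ 2.
Proof.
move=> q_ge0 e_le.
rewrite -(@ler_pXn2r _ 2) ?nnegrE ?sumr_ge0 ?mulr_ge0 ?exprn_ge0 //.
apply: (le_trans (sqr_sum_le _)).
have -> : (q * #|G|%:R ^+ 2) ^+ 2 = #|G|%:R * (q ^+ 2 * #|G|%:R ^+ 3) :> R by ring.
rewrite ler_wpM2l //; under eq_bigr do rewrite real_normK ?num_real //.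
exact: e_le.
Qed.

Section Pseudorandom.
Variables (e1 e2 : G -> R) (b1 b2 p : R).
Hypotheses (e1_01 : forall x, 0 <= e1 x <= 1) (e2_01 : forall x, 0 <= e2 x <= 1).
Hypotheses (sum_e1 : \sum_x e1 x = b1 * #|G|%:R).
Hypotheses (sum_e2 : \sum_x e2 x = b2 * #|G|%:R).
Hypotheses (b1_01 : 0 <= b1 <= 1) (b2_01 : 0 <= b2 <= 1) (p_ge0 : 0 <= p).
(** The fourth power anticipates two square roots: passing from L^2 to L^1 for autocorrelations
    leaves [p ^+ 2], and passing from variance to mean deviation of W leaves [p]. *)
Hypothesis unif1 :
  \sum_k autocorr (fun s => e1 s - b1) k ^+ 2 <= p ^+ 4 * #|G|%:R ^+ 3.
Hypothesis unif2 :
  \sum_k autocorr (fun s => e2 s - b2) k ^+ 2 <= p ^+ 4 * #|G|%:R ^+ 3.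

Let N : R := #|G|%:R.

Lemma sum_autocorr_prod_diff :
  \sum_k `|autocorr e1 k * autocorr e2 k - b1 ^+ 2 * b2 ^+ 2 * N ^+ 2|
    <= 2 * p ^+ 2 * N ^+ 3.
Proof.
have N_ge0 : 0 <= N by exact: ler0n.
pose Phi1 k : R := `|autocorr (fun s => e1 s - b1) k|.
pose Phi2 k : R := `|autocorr (fun s => e2 s - b2) k|.
have le1 : \sum_k Phi1 k <= p ^+ 2 * N ^+ 2.
  by apply: sum_norm_autocorr; rewrite ?sqr_ge0 // -exprM.
have le2 : \sum_k Phi2 k <= p ^+ 2 * N ^+ 2.
  by apply: sum_norm_autocorr; rewrite ?sqr_ge0 // -exprM.
apply: (@le_trans _ _ (\sum_k N * (Phi1 k + Phi2 k))); last first.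
  rewrite -mulr_sumr big_split /=.
  have -> : 2 * p ^+ 2 * N ^+ 3 = N * (p ^+ 2 * N ^+ 2 + p ^+ 2 * N ^+ 2) by ring.
  by rewrite ler_wpM2l // lerD.
apply: ler_sum => k _.
(* The two autocorrelations are replaced by their main terms one at a time; each replacement costs a
   balanced autocorrelation times a factor at most N. *)
have -> : autocorr e1 k * autocorr e2 k - b1 ^+ 2 * b2 ^+ 2 * N ^+ 2 =
  autocorr e2 k * autocorr (fun s => e1 s - b1) k
  + (b1 ^+ 2 * N) * autocorr (fun s => e2 s - b2) k.
  by rewrite (autocorr_balanced k sum_e1) (autocorr_balanced k sum_e2) /N; ring.
apply: (le_trans (ler_normD _ _)); rewrite !normrM mulrDr.
have /andP[? ?] := autocorr_bounds k e2_01.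
have /andP[? ?] := b1_01.
apply: lerD; apply: ler_wpM2r => //; rewrite ?ger0_norm ?sqr_ge0 //.
by rewrite ler_piMl // mulr_ile1.
Qed.

Lemma sum_autocorr_prod_le :
  \sum_k autocorr e1 k * autocorr e2 k
    <= b1 ^+ 2 * b2 ^+ 2 * N ^+ 3 + 2 * p ^+ 2 * N ^+ 3.
Proof.
rewrite -lerBlDl; apply: le_trans sum_autocorr_prod_diff.
have -> : b1 ^+ 2 * b2 ^+ 2 * N ^+ 3 = \sum_(k : G) b1 ^+ 2 * b2 ^+ 2 * N ^+ 2.
  by rewrite sumr_const -[RHS]mulr_natr /N; ring.
by rewrite -sumrB; apply: ler_sum => k _; rewrite ler_norm.
Qed.

(** The constant is exactly the mean of W, so the left side is the second moment minus its main
    term. This is a sum of differences of squares, each at most [2 * N ^+ 2] times a term of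
    [sum_autocorr_prod_diff]. *)
Lemma cube_weight_variance :
  \sum_u \sum_v (cube_weight e1 e2 u v - b1 ^+ 2 * b2 ^+ 2 * N) ^+ 2
    <= 4 * p ^+ 2 * N ^+ 6.
Proof.
have N_ge0 : 0 <= N by exact: ler0n.
set c := b1 ^+ 2 * b2 ^+ 2 * N.
have card2 : #|{: G * G}|%:R = N ^+ 2 :> R by rewrite card_prod natrM.
have -> : \sum_u \sum_v (cube_weight e1 e2 u v - c) ^+ 2 =
  N * \sum_k ((autocorr e1 k * autocorr e2 k) ^+ 2
              - (b1 ^+ 2 * b2 ^+ 2 * N ^+ 2) ^+ 2).
  transitivity (\sum_u \sum_v (cube_weight e1 e2 u v ^+ 2
                - 2 * c * cube_weight e1 e2 u v + c ^+ 2)).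
    by apply: eq_bigr => u _; apply: eq_bigr => v _; ring.
  under eq_bigr do rewrite big_split sumrB /= -mulr_sumr sumr_const -[X in _ + X]mulr_natr card2.
  rewrite big_split sumrB /= -mulr_sumr sumr_const -[X in _ + X]mulr_natr card2.
  rewrite sum_cube_weight sum_cube_weight_sqr sum_e1 sum_e2 sumrB sumr_const.
  rewrite -[X in _ = N * (_ - X)]mulr_natr -/N.
  under [in RHS]eq_bigr do rewrite exprMn.
  by rewrite /c; ring.
apply: (@le_trans _ _ (N * \sum_k 2 * N ^+ 2 *
   `|autocorr e1 k * autocorr e2 k - b1 ^+ 2 * b2 ^+ 2 * N ^+ 2|)); last first.
  rewrite -mulr_sumr.
  have -> : 4 * p ^+ 2 * N ^+ 6 = N * (2 * N ^+ 2 * (2 * p ^+ 2 * N ^+ 3)) by ring.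
  by rewrite !ler_wpM2l ?mulr_ge0 ?sqr_ge0 // sum_autocorr_prod_diff.
rewrite ler_wpM2l //; apply: ler_sum => k _.
have /andP[? ?] := autocorr_bounds k e1_01.
have /andP[? ?] := autocorr_bounds k e2_01.
have /andP[? ?] := b1_01; have /andP[? ?] := b2_01.
apply: (le_trans (ler_norm _)); rewrite subr_sqr normrM mulrC.
rewrite ler_wpM2r // ger0_norm; last first.
  by rewrite addr_ge0 ?mulr_ge0 ?sqr_ge0.
rewrite mulr_natl mulr2n; apply: lerD; first by rewrite expr2 ler_pM.
by rewrite ler_piMl ?sqr_ge0 // mulr_ile1 ?sqr_ge0 ?exprn_ile1.
Qed.

Lemma cube_weight_deviation :
  \sum_u \sum_v `|cube_weight e1 e2 u v - b1 ^+ 2 * b2 ^+ 2 * N|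
    <= 2 * p * N ^+ 5.
Proof.
have N_ge0 : 0 <= N by exact: ler0n.
rewrite (pair_bigA _ (fun u v =>
  `|cube_weight e1 e2 u v - b1 ^+ 2 * b2 ^+ 2 * N|)) /=.
rewrite -(@ler_pXn2r _ 2) ?nnegrE ?sumr_ge0 ?mulr_ge0 ?exprn_ge0 //.
apply: (le_trans (sqr_sum_le _)); rewrite !card_prod !natrM -/N.
have -> : (2 * p * N ^+ 5) ^+ 2 = N * N * (N * N) * (4 * p ^+ 2 * N ^+ 6) by ring.
rewrite ler_wpM2l ?mulr_ge0 //; under eq_bigr do rewrite real_normK ?num_real //.
rewrite -(pair_bigA _ (fun u v =>
  (cube_weight e1 e2 u v - b1 ^+ 2 * b2 ^+ 2 * N) ^+ 2)) /=.
exact: cube_weight_variance.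
Qed.

(** As [box] is at most 1 in absolute value, replacing W by its mean costs at most the total
    deviation of W; the mean then factors out. *)
Lemma box_cube_weight_le g : (forall x y, `|g x y| <= 1) ->
  \sum_u \sum_v box g u v * cube_weight e1 e2 u v
    <= b1 ^+ 2 * b2 ^+ 2 * N * (\sum_y \sum_y' (\sum_x g x y * g x y') ^+ 2)
       + 2 * p * N ^+ 5.
Proof.
move=> g_le1; rewrite -lerBlDl; apply: le_trans cube_weight_deviation.
rewrite -sum_box mulr_sumr -sumrB; apply: ler_sum => u _.
rewrite mulr_sumr -sumrB; apply: ler_sum => v _.
rewrite [_ * box _ _ _]mulrC -mulrBr; apply: (le_trans (ler_norm _)).
by rewrite normrM ler_piMl // !normrM !mulr_ile1 ?mulr_ge0.
Qed.

Lemma corner_sum_pseudorandom_le (a g : G -> G -> R) :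
  (forall x y, 0 <= a x y <= e1 x * e2 y) -> (forall x y, `|g x y| <= 1) ->
  corner_sum g a a ^+ 4 <= (b1 * b2 * N ^+ 2) ^+ 2
    * (b1 ^+ 2 * b2 ^+ 2 * N ^+ 3 + 2 * p ^+ 2 * N ^+ 3)
    * (b1 ^+ 2 * b2 ^+ 2 * N * (\sum_y \sum_y' (\sum_x g x y * g x y') ^+ 2)
       + 2 * p * N ^+ 5).
Proof.
move=> a_le g_le1.
have N_ge0 : 0 <= N by exact: ler0n.
have /andP[? ?] := b1_01; have /andP[? ?] := b2_01.
apply: (le_trans (corner_sum_cauchy_schwarz _ e1_01 e2_01 a_le)).
have -> : (\sum_x e1 x) * (\sum_x e2 x) = b1 * b2 * N ^+ 2.
  by rewrite sum_e1 sum_e2 -/N; ring.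
have S_ge0 : 0 <= \sum_k autocorr e1 k * autocorr e2 k.
  by rewrite -convolution_energy sumr_ge0 // => z _; rewrite sqr_ge0.
apply: (@le_trans _ _ ((b1 * b2 * N ^+ 2) ^+ 2
   * (\sum_k autocorr e1 k * autocorr e2 k)
    * (b1 ^+ 2 * b2 ^+ 2 * N * (\sum_y \sum_y' (\sum_x g x y * g x y') ^+ 2)
       + 2 * p * N ^+ 5))).
  by rewrite ler_wpM2l ?mulr_ge0 ?sqr_ge0 ?box_cube_weight_le.
rewrite ler_wpM2r //; last by rewrite ler_wpM2l ?sqr_ge0 ?sum_autocorr_prod_le.
rewrite addr_ge0 ?mulr_ge0 ?exprn_ge0 //.
by apply: sumr_ge0 => y _; apply: sumr_ge0 => y' _; rewrite sqr_ge0.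
Qed.

End Pseudorandom.

(** * Splitting the box norm and the corner sum *)

(* The cross terms vanish because [f] is orthogonal to [e] on every fibre. *)
Lemma box_norm_add_fiber_const f e (h : G -> R) :
  (forall x, e x * e x = e x) -> (forall y, \sum_x f x y * e x = 0) ->
  \sum_y \sum_y' (\sum_x (f x y + e x * h y) * (f x y' + e x * h y')) ^+ 2
  <= 2 * (\sum_y \sum_y' (\sum_x f x y * f x y') ^+ 2)
     + 2 * ((\sum_x e x) ^+ 2 * (\sum_y h y ^+ 2) ^+ 2).
Proof.
move=> ee f_orth.
have -> : (\sum_x e x) ^+ 2 * (\sum_y h y ^+ 2) ^+ 2 =
  \sum_y \sum_y' ((\sum_x e x) * (h y * h y')) ^+ 2.
  rewrite [X in _ * X]expr2 mulr_suml mulr_sumr; apply: eq_bigr => y _.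
  by rewrite mulr_sumr mulr_sumr; apply: eq_bigr => y' _; ring.
rewrite !mulr_sumr -big_split; apply: ler_sum => y _ /=.
rewrite !mulr_sumr -big_split; apply: ler_sum => y' _ /=.
have -> : \sum_x (f x y + e x * h y) * (f x y' + e x * h y') =
  \sum_x f x y * f x y' + (\sum_x e x) * (h y * h y').
  transitivity (\sum_x (f x y * f x y' + e x * (h y * h y')
     + (f x y * e x * h y' + f x y' * e x * h y))).
    by apply: eq_bigr => x _; rewrite -{3}ee; ring.
  rewrite !big_split /= -!mulr_suml !f_orth; ring.
set s := \sum_x f x y * _; set t := _ * _.
by rewrite -subr_ge0; have := sqr_ge0 (s - t); lra.
Qed.

Lemma corner_sum_decomposition (a : G -> G -> R) (e1 e2 : G -> R) (d : R) :
  (forall x y, e1 x * a x y = a x y) -> (forall x y, e2 y * a x y = a x y) ->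
  corner_sum a a a = d * (\sum_z (\sum_y a (z - y) y) ^+ 2)
    + corner_sum (fun x y => a x y - d * (e1 x * e2 y)) a a.
Proof.
move=> e1a e2a; apply/eqP; rewrite -subr_eq; apply/eqP.
rewrite /corner_sum -sumrB.
transitivity (\sum_x \sum_y \sum_z d * (a (z - y) y * a x (z - x))).
  apply: eq_bigr => x _; rewrite -sumrB; apply: eq_bigr => y _.
  rewrite -sumrB; apply: eq_bigr => z _.
  by rewrite -[in RHS](e2a _ y) -[in RHS](e1a x); ring.
under eq_bigr do rewrite exchange_big /=.
rewrite exchange_big mulr_sumr /=; apply: eq_bigr => z _.
(* Reflecting y to z - y in one copy of the antidiagonal sum turns it into the sum of [a x (z - x)]
   over x. *)
rewrite expr2 -{2}(sum_reflect (fun y => a (z - y) y) z) mulr_sumr mulr_sumr.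
apply: eq_bigr => x _; rewrite mulr_suml mulr_sumr; apply: eq_bigr => y _.
by rewrite subKr.
Qed.

(** The antidiagonals partition the plane, and Cauchy-Schwarz is applied to their masses. *)
Lemma antidiagonal_energy_ge (a : G -> G -> R) :
  (\sum_x \sum_y a x y) ^+ 2
    <= #|G|%:R * \sum_z (\sum_y a (z - y) y) ^+ 2.
Proof.
have -> : \sum_x \sum_y a x y = \sum_z \sum_y a (z - y) y.
  rewrite exchange_big [RHS]exchange_big /=; apply: eq_bigr => y _.
  by rewrite (sum_translate (a^~ y)).
exact: sqr_sum_le.
Qed.

End Group.

(** * The numerical contradiction *)

(* [t] keeps 1/10 abstract: [lra] and unification would compute its powers. *)
Lemma corner_count_contradiction (R : realFieldType) (N b1 b2 d t p B S T : R) :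
  0 < N -> 0 < b1 <= 1 -> 0 < b2 <= 1 -> 0 < d <= 1 -> t = 10^-1 ->
  p = t ^+ 3 * b1 ^+ 4 * b2 ^+ 4 * d ^+ 12 ->
  10 ^+ 10 * (d ^+ 4 * b1 * b2)^-1 <= N ->
  B <= 4 * t ^+ 3 * d ^+ 12 * b1 ^+ 2 * b2 ^+ 2 * N ^+ 4 ->
  T ^+ 4 <= (b1 * b2 * N ^+ 2) ^+ 2
    * (b1 ^+ 2 * b2 ^+ 2 * N ^+ 3 + 2 * p ^+ 2 * N ^+ 3)
    * (b1 ^+ 2 * b2 ^+ 2 * N * B + 2 * p * N ^+ 5) ->
  d * S + T = d * b1 * b2 * N ^+ 2 ->
  (d * b1 * b2 * N ^+ 2) ^+ 2 <= N * S -> False.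
Proof.
move=> N_gt0 /andP[b1_gt0 b1_le1] /andP[b2_gt0 b2_le1] /andP[d_gt0 d_le1].
move=> tE pE N_large B_le T_le ST S_ge.
have t_gt0 : 0 < t by rewrite tE invr_gt0.
have [N_ge0 b1_ge0 b2_ge0] := And3 (ltW N_gt0) (ltW b1_gt0) (ltW b2_gt0).
have [d_ge0 t_ge0] := conj (ltW d_gt0) (ltW t_gt0).
have t_le1 : t <= 1 by rewrite tE; lra.
have t3 : t ^+ 3 = 1000^-1 by rewrite tE; lra.
(* [X] is the lower bound for the main term [d * S]. *)
pose X := d ^+ 3 * b1 ^+ 2 * b2 ^+ 2 * N ^+ 3.
have X_gt0 : 0 < X by rewrite /X !mulr_gt0 ?exprn_gt0.
have dS_ge : X <= d * S.
  rewrite -(@ler_pM2l _ N) //.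
  have -> : N * X = d * (d * b1 * b2 * N ^+ 2) ^+ 2 by rewrite /X; ring.
  by rewrite [N * (d * S)]mulrCA ler_pM2l.
(* The lower bound on N makes the degenerate corners at most half of the main term, so [T] must be
   at most [- X / 2]. *)
have small : 2 * (d * b1 * b2 * N ^+ 2) <= X.
  have -> : X = d ^+ 2 * b1 * b2 * N * (d * b1 * b2 * N ^+ 2) by rewrite /X; ring.
  rewrite ler_pM2r ?mulr_gt0 ?exprn_gt0 //.
  have D_gt0 : 0 < d ^+ 4 * b1 * b2 by rewrite !mulr_gt0 ?exprn_gt0.
  have D_le : d ^+ 4 * b1 * b2 * N <= d ^+ 2 * b1 * b2 * N.
    by do 3!rewrite ler_wpM2r //; rewrite ler_wiXn2l.
  apply: le_trans D_le.
  move: N_large; rewrite ler_pdivrMr // mulrC; apply: le_trans.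
  by rewrite -natrX ler_nat.
have T_ge : X / 2 <= - T by lra.
have : (X / 2) ^+ 4 <= (- T) ^+ 4.
  by rewrite lerXn2r ?nnegrE ?(le_trans _ T_ge) // divr_ge0 // ltW.
have -> : (- T) ^+ 4 = T ^+ 4 by ring.
move=> /le_trans/(_ T_le).
(* [u] is [X ^+ 4]. *)
pose u := b1 ^+ 8 * b2 ^+ 8 * N ^+ 12 * d ^+ 12.
have u_gt0 : 0 < u by rewrite /u !mulr_gt0 ?exprn_gt0.
have -> : (X / 2) ^+ 4 = u / 16 by rewrite /X /u; field.
have p_ge0 : 0 <= p by rewrite pE !mulr_ge0 ?exprn_ge0.
have first_le : b1 ^+ 2 * b2 ^+ 2 * N ^+ 3 + 2 * p ^+ 2 * N ^+ 3
   <= 2 * b1 ^+ 2 * b2 ^+ 2 * N ^+ 3.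
  have -> : 2 * b1 ^+ 2 * b2 ^+ 2 * N ^+ 3 =
    b1 ^+ 2 * b2 ^+ 2 * N ^+ 3 + b1 ^+ 2 * b2 ^+ 2 * N ^+ 3 by ring.
  rewrite lerD2l ler_wpM2r ?exprn_ge0 //.
  have -> : 2 * p ^+ 2 = b1 ^+ 2 * b2 ^+ 2 *
    (2 * (t ^+ 3) ^+ 2 * (b1 ^+ 6 * b2 ^+ 6 * d ^+ 24)) by rewrite pE; ring.
  rewrite ger_pMr ?mulr_gt0 ?exprn_gt0 //.
  have bd_le1 : b1 ^+ 6 * b2 ^+ 6 * d ^+ 24 <= 1.
    by rewrite !mulr_ile1 ?exprn_ile1 ?mulr_ge0 ?exprn_ge0.
  by apply: (le_trans (ler_wpM2l _ bd_le1)); rewrite t3; lra.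
have second_le : b1 ^+ 2 * b2 ^+ 2 * N * B + 2 * p * N ^+ 5
   <= 6 * t ^+ 3 * d ^+ 12 * b1 ^+ 4 * b2 ^+ 4 * N ^+ 5.
  have -> : 6 * t ^+ 3 * d ^+ 12 * b1 ^+ 4 * b2 ^+ 4 * N ^+ 5 =
    b1 ^+ 2 * b2 ^+ 2 * N * (4 * t ^+ 3 * d ^+ 12 * b1 ^+ 2 * b2 ^+ 2 * N ^+ 4)
    + 2 * p * N ^+ 5 by rewrite pE; ring.
  by rewrite lerD2r ler_wpM2l // !mulr_ge0 ?exprn_ge0.
move=> u_le.
(* The factors 2 of [first_le] and 6 of [second_le] give 12; since 12/1000 < 1/16, this bound is
   impossible. *)
suff : u / 16 <= 12 * t ^+ 3 * u by rewrite t3; lra.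
apply: (le_trans u_le).
have -> : 12 * t ^+ 3 * u = (b1 * b2 * N ^+ 2) ^+ 2 * (2 * b1 ^+ 2 * b2 ^+ 2 * N ^+ 3)
  * (6 * t ^+ 3 * d ^+ 12 * b1 ^+ 4 * b2 ^+ 4 * N ^+ 5) by rewrite /u; ring.
apply: (@le_trans _ _ ((b1 * b2 * N ^+ 2) ^+ 2
  * (b1 ^+ 2 * b2 ^+ 2 * N ^+ 3 + 2 * p ^+ 2 * N ^+ 3)
  * (6 * t ^+ 3 * d ^+ 12 * b1 ^+ 4 * b2 ^+ 4 * N ^+ 5))).
  apply: ler_wpM2l second_le.
  by rewrite !mulr_ge0 ?addr_ge0 ?mulr_ge0 ?exprn_ge0 ?mulr_ge0 ?exprn_ge0.
apply: ler_wpM2r; first by rewrite !mulr_ge0 ?exprn_ge0.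
by apply: ler_wpM2l first_le; rewrite sqr_ge0.
Qed.

(** * From indicators of sets to functions on the group *)

Lemma sum_indicator (R : rcfType) (T : finType) (S : {set T}) :
  \sum_x indicator R S x = #|S|%:R.
Proof.
rewrite -sum1_card natr_sum [RHS]big_mkcond /=; apply: eq_bigr => x _.
by rewrite /indicator; case: (x \in S).
Qed.

Lemma sum_indicator_pair (R : rcfType) (T : finType) (S : {set T * T}) :
  \sum_x \sum_y indicator R S (x, y) = #|S|%:R.
Proof. by rewrite pair_bigA -sum_indicator; apply: eq_bigr => -[]. Qed.

Lemma indicator_01 (R : rcfType) (T : finType) (S : {set T}) x :
  0 <= indicator R S x <= 1.
Proof. by rewrite /indicator ler0n lern1 leq_b1. Qed.

Lemma indicator_idem (R : rcfType) (T : finType) (S : {set T}) x :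
  indicator R S x * indicator R S x = indicator R S x.
Proof. by rewrite /indicator -natrM mulnb andbb. Qed.

Lemma sum_autocorr_balanced_le (R : rcfType) (n : nat) (E : {set 'I_n.+1})
    (b q : R) :
  #|E|%:R = b * n.+1%:R -> set_uniform (q ^+ 4) E ->
  \sum_k autocorr (fun s => indicator R E s - b) k ^+ 2
    <= q ^+ 4 * #|{: 'I_n.+1}|%:R ^+ 3.
Proof.
move=> cardE unifE; rewrite card_ord; apply: le_trans unifE.
have -> : b = set_density R E by rewrite /set_density cardE mulfK ?pnatr_eq0.
by apply: ler_sum => k _; rewrite real_normK ?num_real.
Qed.

(** [g] subtracts the global density where the balanced function subtracts fibre densities. The
    difference is constant in x on E1 for each y, so [box_norm_add_fiber_const] applies. *)
Lemma box_norm_balanced_rel (R : rcfType) (n : nat)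
    (E1 E2 : {set 'I_n.+1}) (A : {set 'I_n.+1 * 'I_n.+1}) (d alpha s : R)
    (g : 'I_n.+1 -> 'I_n.+1 -> R) :
  (forall x y, g x y =
     indicator R A (x, y) - d * (indicator R E1 x * indicator R E2 y)) ->
  A \subset setX E1 E2 -> basis_uniform alpha E1 E2 A ->
  \sum_(y in E2) `| fiber_density R E1 A y - d | ^+ 2 <= s ->
  \sum_y \sum_y' (\sum_x g x y * g x y') ^+ 2
    <= 2 * (alpha * #|E1|%:R ^+ 2 * #|E2|%:R ^+ 2) + 2 * (#|E1|%:R ^+ 2 * s ^+ 2).
Proof.
move=> g_def subA unifA fibers.
pose h y := (fiber_density R E1 A y - d) * indicator R E2 y.
have gE x y : g x y = balanced_rel R E1 E2 A x y + indicator R E1 x * h y.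
  rewrite g_def /h /balanced_rel /indicator in_setX.
  case: (boolP ((x, y) \in A)) => [/(subsetP subA)|_]; last first.
    by case: (x \in E1); case: (y \in E2) => /=; ring.
  by rewrite in_setX => /andP[-> ->] /=; ring.
have sum_h : \sum_y h y ^+ 2 <= s.
  apply: le_trans fibers; rewrite [leRHS]big_mkcond; apply: ler_sum => y _ /=.
  rewrite /h /indicator; case: (y \in E2); rewrite ?mulr1 ?mulr0 ?expr0n //=.
  by rewrite real_normK ?num_real.
under eq_bigr do under eq_bigr do under eq_bigr do rewrite !gE.
apply: (le_trans (box_norm_add_fiber_const _ (indicator_idem R E1) _)) => [y|].
  have -> : \sum_x balanced_rel R E1 E2 A x y * indicator R E1 x =
     indicator R E2 y * (\sum_x indicator R A (x, y) * indicator R E1 x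
       - fiber_density R E1 A y * \sum_x indicator R E1 x).
    rewrite mulrBr 3!mulr_sumr -sumrB; apply: eq_bigr => x _.
    rewrite /balanced_rel /indicator in_setX.
    by case: (x \in E1); case: (y \in E2) => /=; ring.
  have -> : \sum_x indicator R A (x, y) * indicator R E1 x =
      #|[set x in E1 | (x, y) \in A]|%:R.
    rewrite -sum_indicator; apply: eq_bigr => x _.
    by rewrite /indicator inE -natrM mulnb andbC.
  rewrite sum_indicator /fiber_density.
  (* If E1 is empty the division cannot be undone, but then the fibre count is 0 as well. *)
  have [E1_eq0|E1_neq0] := eqVneq (#|E1|%:R : R) 0; last by rewrite divfK // subrr mulr0.
  rewrite E1_eq0 mulr0 subr0; move/eqP: E1_eq0; rewrite pnatr_eq0 cards_eq0.
  move=> /eqP->; rewrite (_ : [set x in _ | _] = set0) ?cards0 ?mulr0 //.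
  by apply/setP => x; rewrite !inE.
rewrite sum_indicator; apply: lerD; rewrite ler_wpM2l //.
  apply: le_trans unifA; apply: ler_sum => y _; apply: ler_sum => y' _.
  by rewrite real_normK ?num_real.
rewrite ler_wpM2l ?sqr_ge0 // lerXn2r ?nnegrE ?(le_trans _ sum_h) //;
  by apply: sumr_ge0 => y _; rewrite sqr_ge0.
Qed.

(** A nonzero term with z different from x + y would be a corner with difference z - y - x; the
    terms with z = x + y are cubes of an indicator. *)
Lemma corner_sum_no_corner (R : rcfType) (n : nat) (A : {set 'I_n.+1 * 'I_n.+1}) :
  ~ has_corner A ->
  corner_sum (fun x y => indicator R A (x, y)) (fun x y => indicator R A (x, y))
    (fun x y => indicator R A (x, y)) = #|A|%:R.
Proof.
move=> noA; rewrite -sum_indicator_pair.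
apply: eq_bigr => x _; apply: eq_bigr => y _.
rewrite (bigD1 (x + y)) //= addrK [x + y]addrC addrK big1 ?addr0 => [|z z_neq].
  by rewrite !indicator_idem.
rewrite /indicator -!natrM !mulnb.
have [/andP[/andP[xyA zyA] xzA]|//] := boolP (_ && _).
case: noA; exists x, y, (z - y - x); split=> //.
- by rewrite -addrA -opprD subr_eq0.
- by rewrite [x + _]addrC subrK.
- by rewrite [y + _]addrC addrAC subrK.
Qed.

(* The size of A is recorded as a quotient: with x / 0 = 0, the hypothesis
   0 < delta then makes E1 and E2 nonempty, as the inverse of
   delta^4 beta1 beta2 and the fibre densities presuppose. *)
Theorem theorem3p9 (R : rcfType) (n : nat)
    (E1 E2 : {set 'I_n.+1}) (A : {set 'I_n.+1 * 'I_n.+1})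
    (beta1 beta2 delta alpha : R)
    (cardE1 : #|E1|%:R = beta1 * n.+1%:R)
    (cardE2 : #|E2|%:R = beta2 * n.+1%:R)
    (subA : A \subset setX E1 E2)
    (cardA : #|A|%:R / (#|E1|%:R * #|E2|%:R) = delta)
    (delta_gt0 : 0 < delta)
    (unifE1 : set_uniform
       ((10 ^+ 330)^-1 * beta1 ^+ 24 * beta2 ^+ 24 * delta ^+ 132) E1)
    (unifE2 : set_uniform
       ((10 ^+ 330)^-1 * beta1 ^+ 24 * beta2 ^+ 24 * delta ^+ 132) E2)
    (def_alpha : alpha = (10 ^+ 108)^-1 * delta ^+ 44)
    (unifA : basis_uniform alpha E1 E2 A)
    (N_large : 10 ^+ 10 * (delta ^+ 4 * beta1 * beta2)^-1 <= n.+1%:R)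
    (fibersA : \sum_(y in E2) `| fiber_density R E1 A y - delta | ^+ 2
                 <= alpha * beta2 * n.+1%:R) :
  has_corner A.
Proof.
(* Over a finite group the existence of a corner is decidable, which permits arguing by
   contradiction. *)
case: (boolP [exists a, exists b, exists d,
    [&& d != 0, (a, b) \in A, (a + d, b) \in A & (a, b + d) \in A]]) => [|noA].
  by case/existsP => a /existsP[b /existsP[d /and4P[? ? ? ?]]]; exists a, b, d.
have noC : ~ has_corner A.
  case=> a [b [d [d0 A1 A2 A3]]]; case/negP: noA.
  apply/existsP; exists a; apply/existsP; exists b; apply/existsP; exists d.
  exact/and4P.
exfalso.
have cardG : #|{: 'I_n.+1}|%:R = n.+1%:R :> R by rewrite card_ord.
set N : R := n.+1%:R in cardE1 cardE2 N_large fibersA cardG.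
have N_gt0 : 0 < N by rewrite ltr0n.
have prodE_neq0 : (#|E1|%:R * #|E2|%:R : R) != 0.
  by apply: contraTneq delta_gt0 => E0; rewrite -cardA E0 invr0 mulr0 ltxx.
have density_01 (E : {set 'I_n.+1}) (b : R) :
    #|E|%:R = b * N -> #|E|%:R != 0 :> R -> 0 < b <= 1.
  move=> cardE E_neq0; rewrite -(pmulr_lgt0 _ N_gt0) -cardE lt0r E_neq0 ler0n /=.
  by rewrite -(ler_pM2r N_gt0) -cardE mul1r -cardG ler_nat max_card.
have [E1_neq0 E2_neq0] : #|E1|%:R != 0 :> R /\ #|E2|%:R != 0 :> R.
  by apply/andP; rewrite -negb_or -mulf_eq0.
have b1_01 := density_01 _ _ cardE1 E1_neq0.
have b2_01 := density_01 _ _ cardE2 E2_neq0.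
have card_A : #|A|%:R = delta * beta1 * beta2 * N ^+ 2.
  have -> : #|A|%:R = delta * (#|E1|%:R * #|E2|%:R) by rewrite -cardA divfK.
  by rewrite cardE1 cardE2; ring.
have d_01 : 0 < delta <= 1.
  rewrite delta_gt0 -cardA ler_pdivrMr ?lt0r ?prodE_neq0 ?mulr_ge0 // mul1r.
  by rewrite -natrM ler_nat -cardsX subset_leq_card.
have /andP[b1_gt0 b1_le1] := b1_01; have /andP[b2_gt0 b2_le1] := b2_01.
have /andP[_ d_le1] := d_01.
have [b1_ge0 b2_ge0 d_ge0] := And3 (ltW b1_gt0) (ltW b2_gt0) (ltW delta_gt0).
have N_ge0 := ltW N_gt0.
(* Opaque, so that the 330th power of 1/10 is never computed. *)
have [t tE] : exists t : R, t = 10^-1 by exists 10^-1.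
have t_ge0 : 0 <= t by rewrite tE invr_ge0.
have t_le1 : t <= 1 by rewrite tE invf_le1 // ler1n.
(* The exponents give [2 * p * N ^+ 5] the same form as the box-norm term of the final count. All
   bases are at most 1, so [p ^+ 4] dominates the given uniformity. *)
pose p := t ^+ 3 * beta1 ^+ 4 * beta2 ^+ 4 * delta ^+ 12.
have p_ge0 : 0 <= p by rewrite !mulr_ge0 ?exprn_ge0.
have uniform_p (E : {set 'I_n.+1}) : set_uniform
    ((10 ^+ 330)^-1 * beta1 ^+ 24 * beta2 ^+ 24 * delta ^+ 132) E ->
  set_uniform (p ^+ 4) E.
  move=> unifE; apply: (le_trans unifE); rewrite ler_wpM2r ?exprn_ge0 //.
  have -> : p ^+ 4 = t ^+ 12 * beta1 ^+ 16 * beta2 ^+ 16 * delta ^+ 48.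
    by rewrite /p; ring.
  rewrite -exprVn -tE.
  do 3!(apply: ler_pM; [by rewrite !(exprn_ge0, mulr_ge0) | exact: exprn_ge0 |
    | exact: ler_wiXn2l]).
  exact: ler_wiXn2l.
have {}unifE1 := uniform_p _ unifE1; have {uniform_p} {}unifE2 := uniform_p _ unifE2.
have alpha_ge0 : 0 <= alpha.
  by rewrite def_alpha -exprVn -tE mulr_ge0 ?exprn_ge0.
have alpha_le : alpha <= t ^+ 3 * delta ^+ 12.
  rewrite def_alpha -exprVn -tE.
  by apply: ler_pM; rewrite ?exprn_ge0 // ler_wiXn2l.
clear def_alpha; pose e1 := indicator R E1; pose e2 := indicator R E2.
pose a x y := indicator R A (x, y).
pose g x y := a x y - delta * (e1 x * e2 y).
have a_e1 x y : e1 x * a x y = a x y.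
  rewrite /a /e1 /indicator; case: (boolP ((x, y) \in A)) => [|_]; rewrite ?mulr0 //.
  by move=> /(subsetP subA); rewrite in_setX => /andP[-> _]; rewrite mulr1.
have a_e2 x y : e2 y * a x y = a x y.
  rewrite /a /e2 /indicator; case: (boolP ((x, y) \in A)) => [|_]; rewrite ?mulr0 //.
  by move=> /(subsetP subA); rewrite in_setX => /andP[_ ->]; rewrite mulr1.
have a_le x y : 0 <= a x y <= e1 x * e2 y.
  have /andP[-> a_le1] := indicator_01 R A (x, y).
  have /andP[? _] := indicator_01 R E1 x; have /andP[? _] := indicator_01 R E2 y.
  by rewrite /= -(a_e1 x) -(a_e2 x y) mulrA ler_piMr ?mulr_ge0.
have g_le1 x y : `|g x y| <= 1.
  have /andP[a_ge0 a_le1] := indicator_01 R A (x, y).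
  have /andP[? ?] := indicator_01 R E1 x; have /andP[? ?] := indicator_01 R E2 y.
  have : 0 <= delta * (e1 x * e2 y) <= 1.
    by rewrite !mulr_ge0 //= !mulr_ile1 ?mulr_ge0.
  by move=> /andP[? ?]; rewrite ler_norml /g /a; apply/andP; split; lra.
have sum_e1 : \sum_x e1 x = beta1 * #|{: 'I_n.+1}|%:R.
  by rewrite sum_indicator cardG.
have sum_e2 : \sum_x e2 x = beta2 * #|{: 'I_n.+1}|%:R.
  by rewrite sum_indicator cardG.
have b1_01' : 0 <= beta1 <= 1 by apply/andP.
have b2_01' : 0 <= beta2 <= 1 by apply/andP.
have T_le := corner_sum_pseudorandom_le
  (indicator_01 R E1) (indicator_01 R E2) sum_e1 sum_e2
  b1_01' b2_01'
  p_ge0 (sum_autocorr_balanced_le cardE1 unifE1)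
  (sum_autocorr_balanced_le cardE2 unifE2) a_le g_le1.
have B_le := box_norm_balanced_rel (g := g) (fun _ _ => erefl) subA unifA fibersA.
rewrite cardG in T_le.
apply: (corner_count_contradiction N_gt0 b1_01 b2_01 d_01 tE (erefl p)
  N_large _ T_le).
- apply: (le_trans B_le); rewrite cardE1 cardE2.
  (* The fibre variance enters squared, hence as [alpha ^+ 2]; it is absorbed because [alpha <= 1],
     and 2 + 2 gives the constant 4. *)
  have -> : 2 * (alpha * (beta1 * N) ^+ 2 * (beta2 * N) ^+ 2)
      + 2 * ((beta1 * N) ^+ 2 * (alpha * beta2 * N) ^+ 2)
    = (2 * alpha + 2 * alpha ^+ 2) * (beta1 ^+ 2 * beta2 ^+ 2 * N ^+ 4) by ring.
  have -> : 4 * t ^+ 3 * delta ^+ 12 * beta1 ^+ 2 * beta2 ^+ 2 * N ^+ 4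
    = 4 * (t ^+ 3 * delta ^+ 12) * (beta1 ^+ 2 * beta2 ^+ 2 * N ^+ 4) by ring.
  rewrite ler_wpM2r ?mulr_ge0 ?exprn_ge0 //.
  have alpha_le1 : alpha <= 1.
    by rewrite (le_trans alpha_le) // mulr_ile1 ?exprn_ge0 ?exprn_ile1.
  have : alpha ^+ 2 <= alpha by rewrite expr2 ler_piMr.
  by move: alpha_le; lra.
- by rewrite -card_A -(corner_sum_no_corner R noC) (corner_sum_decomposition delta a_e1 a_e2).
- rewrite -card_A -cardG -sum_indicator_pair.
  exact: antidiagonal_energy_ge.
Qed.
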